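(* Let $\alpha_1,\alpha_2\in(0,1)$, $\lambda_1,\lambda_2>0$, $c_1,c_2\ge0$ with $c_1+c_2=1$, and let $\mu>0$ satisfy $\mu\le\lambda_i/2$ for $i=1,2$. Let $N$ be a homogeneous Poisson process with intensity $\mu$, independent of the mixture tempered stable subordinator $S_{\alpha_1,\lambda_1,\alpha_2,\lambda_2}(t)$, and let $X(t)=N(S_{\alpha_1,\lambda_1,\alpha_2,\lambda_2}(t))$. Then the marginal distribution $r(k,t)=\mathbb{P}(X(t)=k)$ satisfies the fractional difference-differential equation $$\frac{d}{dt}r(k,t)=-\sum_{i=1}^2c_i\Big\{\big(\lambda_i+\mu(1-B)\big)^{\alpha_i}-\lambda_i^{\alpha_i}\Big\}r(k,t),$$ with the conditions $r(0,0)=1$ and $r(k,0)=0$ for $k\neq0$.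
   Context: The mixture tempered stable subordinator (MTSS) $S_{\alpha_1,\lambda_1,\alpha_2,\lambda_2}(t)$, $t\ge0$, is the nondecreasing Lévy process with Laplace transform $$\mathbb{E}\big(e^{-sS_{\alpha_1,\lambda_1,\alpha_2,\lambda_2}(t)}\big)=\exp\Big(-t\big(c_1((s+\lambda_1)^{\alpha_1}-\lambda_1^{\alpha_1})+c_2((s+\lambda_2)^{\alpha_2}-\lambda_2^{\alpha_2})\big)\Big),\quad s>0 .$$ $B$ is the backward shift operator in $k$: $B\,r(k,t)=r(k-1,t)$, with $r(k,t)=0$ for $k<0$. The fractional difference operator is defined by the binomial expansion $$\big(\lambda+\mu(1-B)\big)^{\alpha}=\sum_{l=0}^\infty\binom{\alpha}{l}\lambda^{\alpha-l}\mu^l(1-B)^l,\qquad(1-B)^l=\sum_{m=0}^l\binom lm(-1)^mB^m .$$ *)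

(* Defs.v *)
From HB Require Import structures.
From mathcomp Require Import all_boot all_order all_algebra.
From mathcomp Require Import all_classical all_reals all_analysis.

Set Implicit Arguments.
Unset Strict Implicit.
Unset Printing Implicit Defensive.

Import Order.TTheory GRing.Theory Num.Theory.
Import numFieldNormedType.Exports.

Local Open Scope classical_set_scope.
Local Open Scope ring_scope.

(* A stochastic process is a family indexed by R of which only the members
   with index t >= 0 are ever constrained. *)

Section Processes.
Context {R : realType} {d : measure_display} {T : measurableType d}.
Variable P : probability T R.

(* The product rule over all of 'I_n gives the rule for every subfamily, by
   taking B i = setT for the indices left out. *)
Definition mutually_independent (n : nat) (Y : 'I_n -> T -> R) : Prop :=
  forall B : 'I_n -> set R, (forall i, measurable (B i)) ->
    P (\bigcap_(i in [set: 'I_n]) (Y i @^-1` B i)) =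
    (\prod_(i < n) P (Y i @^-1` B i))%E.

Definition independent_increments (Y : R -> T -> R) : Prop :=
  forall (n : nat) (t : nat -> R), 0 <= t 0%N ->
    {homo t : i j / (i <= j)%N >-> i <= j} ->
    mutually_independent (fun (i : 'I_n) w => Y (t i.+1) w - Y (t i) w).

Definition stationary_increments (Y : R -> T -> R) : Prop :=
  forall (s h : R) (B : set R), 0 <= s -> 0 <= h -> measurable B ->
    P [set w | B (Y (s + h) w - Y s w)] = P [set w | B (Y h w - Y 0 w)].

Definition stochastically_continuous (Y : R -> T -> R) : Prop :=
  forall s e : R, 0 <= s -> 0 < e ->
    P [set w | e < `|Y t w - Y s w|]
      @[t --> within [set t | 0 <= t] (nbhs s)] --> 0%E.

Definition is_levy_process (Y : R -> T -> R) : Prop :=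
  [/\ {ae P, forall w, Y 0 w = 0},
      independent_increments Y,
      stationary_increments Y &
      stochastically_continuous Y].

(* The values are nonnegative for every w, not just almost every w, since
   they are used as times of another process. *)
Definition is_subordinator (S : R -> T -> R) : Prop :=
  [/\ is_levy_process S,
      forall t w, 0 <= t -> 0 <= S t w &
      {ae P, forall w, forall s t, 0 <= s -> s <= t -> S s w <= S t w}].

Definition mtss_exponent (alpha lambda c : 'I_2 -> R) (s : R) : R :=
  \sum_(i < 2)
    c i * ((s + lambda i) `^ alpha i - lambda i `^ alpha i).

Definition is_mtss (alpha lambda c : 'I_2 -> R) (S : R -> T -> R) : Prop :=
  is_subordinator S /\
  forall t s : R, 0 <= t -> 0 < s ->
    ('E_P[fun w => expR (- s * S t w)]
       = (expR (- t * mtss_exponent alpha lambda c s))%:E)%E.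

(* A counting process (every path is nondecreasing and right-continuous) with
   independent increments, N t - N s being Poisson of parameter mu (t - s).
   The path conditions hold for every w, so that w |-> N (S t w) w is
   measurable although P need not be complete. *)
Definition is_poisson_process (mu : R) (N : R -> T -> nat) : Prop :=
  [/\ forall w s t, 0 <= s -> s <= t -> (N s w <= N t w)%N,
      forall w t, 0 <= t -> ((N u w)%:R : R) @[u --> t^'+] --> ((N t w)%:R : R),
      {ae P, forall w, N 0 w = 0%N},
      independent_increments (fun t w => (N t w)%:R) &
      forall (s t : R) (k : nat), 0 <= s -> s < t ->
        P [set w | (N t w - N s w)%N = k] =
        (poisson_pmf (mu * (t - s)) k)%:E].

Definition process_sigma_algebra {d'} {U : measurableType d'}
    (Y : R -> T -> U) : set (set T) :=
  <<s [set A | exists t (B : set U),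
         [/\ 0 <= t, measurable B & A = Y t @^-1` B]] >>.

Definition independent_processes {d1 d2}
    {U1 : measurableType d1} {U2 : measurableType d2}
    (Y1 : R -> T -> U1) (Y2 : R -> T -> U2) : Prop :=
  forall A B, process_sigma_algebra Y1 A -> process_sigma_algebra Y2 B ->
    P (A `&` B) = (P A * P B)%E.

Definition time_changed (N : R -> T -> nat) (S : R -> T -> R)
    (t : R) (w : T) : nat := N (S t w) w.

(* The integer index makes the backward shift total: the event is empty, and
   the value 0, for k < 0. *)
Definition marginal (X : R -> T -> nat) (k : int) (t : R) : R :=
  fine (P [set w | (X t w)%:Z = k]).

End Processes.

Section FractionalDifference.
Context {R : realType}.

Definition gbinomial (a : R) (l : nat) : R :=
  (\prod_(i < l) (a - i%:R)) / l`!%:R.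

Definition backward_shift (f : int -> R) : int -> R := fun k => f (k - 1).

Definition one_minus_B_pow (l : nat) (f : int -> R) (k : int) : R :=
  \sum_(m < l.+1) 'C(l, m)%:R * (- 1) ^+ m * iter m backward_shift f k.

Definition frac_difference_term (lambda mu a : R) (f : int -> R) (k : int)
    (l : nat) : R :=
  gbinomial a l * lambda `^ (a - l%:R) * mu ^+ l * one_minus_B_pow l f k.

(* (lambda + mu (1 - B)) ^ a applied to f, at k; meaningful only when the
   series converges. *)
Definition frac_difference (lambda mu a : R) (f : int -> R) (k : int) : R :=
  limn (series (frac_difference_term lambda mu a f k)).

End FractionalDifference.

(* Main.v *)
(* Conditioning on the subordinator gives
     r k t = E[(mu S_t)^k / k! exp(- mu S_t)] = (- mu)^k / k! L_t^(k)(mu),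
   where L_t = exp(- t psi) is the Laplace transform of S_t; the conditioning
   discretizes S_t from above, N being only right-continuous. Differentiating
   L_t' = - t psi' L_t repeatedly gives the Panjer recursion
     (k + 1) r (k + 1) t = - t \sum_(j <= k) (j + 1) a_(j + 1) r (k - j) t,
   with a_j = (- mu)^j / j! psi^(j)(mu), and by induction on k this recursion
   implies r' k t = - \sum_(j <= k) a_j r (k - j) t, with no interchange of
   t- and s-derivatives. Since r vanishes at negative indices, expanding the
   powers (1 - B)^l at k only involves the shifts B^0, ..., B^k, and the
   binomial series identifies the coefficient of B^j with the one in a_j. *)
Require Import Defs.
From HB Require Import structures.
From mathcomp Require Import all_boot all_order all_algebra.
From mathcomp Require Import all_classical all_reals all_analysis.
From mathcomp Require Import measurable_realfun ring lra zify.

Set Implicit Arguments.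
Unset Strict Implicit.
Unset Printing Implicit Defensive.

Import Order.TTheory GRing.Theory Num.Theory.
Import numFieldNormedType.Exports.

Local Open Scope classical_set_scope.
Local Open Scope ring_scope.

(** * Binomial series and the fractional difference operator *)

Section BinomialSeries.
Context {R : realType}.
Implicit Types (a x : R) (l m n : nat).

Lemma gbinomial0 a : gbinomial a 0 = 1.
Proof. by rewrite /gbinomial big_ord0 fact0 divr1. Qed.

Lemma gbinomialS a l :
  l.+1%:R * gbinomial a l.+1 = (a - l%:R) * gbinomial a l.
Proof.
rewrite /gbinomial big_ord_recr /= factS natrM.
have h1 : l.+1%:R != 0 :> R by rewrite pnatr_eq0.
have h2 : l`!%:R != 0 :> R by rewrite pnatr_eq0 -lt0n fact_gt0.
by field; rewrite h2 nat1r.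
Qed.

Lemma gbinomial_diag a l :
  l.+1%:R * gbinomial a l.+1 = a * gbinomial (a - 1) l.
Proof.
rewrite /gbinomial big_ord_recl /= factS natrM subr0.
rewrite (eq_bigr (fun i : 'I_l => a - 1 - i%:R)); last first.
  by move=> i _; rewrite /bump leq0n natrD opprD addrA.
have h1 : l.+1%:R != 0 :> R by rewrite pnatr_eq0.
have h2 : l`!%:R != 0 :> R by rewrite pnatr_eq0 -lt0n fact_gt0.
by field; rewrite h2 nat1r.
Qed.

(** The falling product splits after its first [m] factors; this pulls the coefficient of [B^m] out
    of the binomial series. *)
Lemma gbinomial_bin a m n :
  gbinomial a (m + n) * 'C(m + n, m)%:R =
  gbinomial a m * gbinomial (a - m%:R) n.
Proof.
rewrite /gbinomial big_split_ord /=.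
rewrite [in LHS](eq_bigr (fun i : 'I_n => a - m%:R - i%:R)); last first.
  by move=> i _; rewrite natrD opprD addrA.
have /(congr1 (fun z => z%:R : R)) := bin_fact (leq_addr n m).
rewrite addKn !natrM => <-.
have fN0 l : l`!%:R != 0 :> R by rewrite pnatr_eq0 -lt0n fact_gt0.
have bN0 : 'C(m + n, m)%:R != 0 :> R by rewrite pnatr_eq0 -lt0n bin_gt0 leq_addr.
by field; rewrite ?fN0 ?bN0.
Qed.

Lemma cvg_series_ratio (u : R^nat) (q : R) (N : nat) : 0 <= q < 1 ->
  (forall n, (N <= n)%N -> `|u n.+1| <= q * `|u n|) -> cvgn (series u).
Proof.
move=> /andP[q0 q1] uq; apply: normed_cvg.
rewrite -(is_cvg_series_restrict N).
have uN k : `|u (N + k)%N| <= `|u N| * q ^+ k.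
  elim: k => [|k IH]; first by rewrite addn0 expr0 mulr1.
  rewrite addnS (le_trans (uq _ (leq_addr _ _)))// exprS mulrCA.
  by rewrite ler_wpM2l.
suff /cvg_ex[l ul] : cvgn (series (fun k => `|u (N + k)%N|)).
  apply/cvg_ex; exists l; rewrite -(cvg_shiftn N) /=.
  rewrite [X in X @ _ --> _](_ : _ = series (fun k => `|u (N + k)%N|))//.
  apply/funext => n.
  rewrite /series /= -{1}(add0n N) big_addn addnK.
  by apply: eq_bigr => i _; rewrite addnC.
apply: (@series_le_cvg _ _ (geometric `|u N| q)) => //=.
- by move=> n; rewrite mulr_ge0// exprn_ge0.
- by apply: is_cvg_geometric_series; rewrite ger0_norm.
Qed.

Lemma is_cvg_pseries_gbinomial a x : `|x| < 1 ->
  cvgn (pseries (gbinomial a) x).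
Proof.
move=> x1; pose q := (1 + `|x|) / 2.
have q1 : q < 1 by rewrite /q; lra.
have x0 : 0 <= `|x| by [].
(* Beyond this index [|a| + 1 < (q - |x|) n], whence [(|a| + n) |x| <= q (n + 1)]. *)
pose N := Num.truncn ((`|a| + 1) / (q - `|x|)).
have qx : 0 < q - `|x| by rewrite /q; lra.
apply: (@cvg_series_ratio _ q N.+1); first by rewrite q1 andbT /q; lra.
move=> n Nn.
rewrite -(@ler_pM2l _ n.+1%:R)// -{1}(@ger0_norm _ n.+1%:R)// -normrM mulrA.
rewrite gbinomialS exprS [leLHS](_ : _ =
  (`|a - n%:R| * `|x|) * `|gbinomial a n * x ^+ n|); last first.
  by rewrite -!normrM; congr `|_|; ring.
rewrite mulrA ler_wpM2r//.
have h : (`|a| + 1) / (q - `|x|) < n%:R.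
  by rewrite (lt_le_trans (truncnS_gt _))// ler_nat.
rewrite ltr_pdivrMr// in h.
have : `|a - n%:R| <= `|a| + n%:R by rewrite (le_trans (ler_normB _ _))// normr_nat.
move=> /(ler_wpM2r x0) /le_trans; apply.
rewrite -natr1.
have : `|a| * `|x| <= `|a| by rewrite ler_piMr// ltW.
rewrite /q in h *; nra.
Qed.

Lemma pseries_diffs_gbinomial a :
  pseries_diffs (gbinomial a) = (fun l => a * gbinomial (a - 1) l).
Proof. by apply/funext => l; rewrite /pseries_diffs gbinomial_diag. Qed.

Lemma pseriesZ (c : R^nat) a x :
  pseries (fun l => a * c l) x = (fun n => a * pseries c x n).
Proof.
apply/funext => n; rewrite /pseries /series /= mulr_sumr.
by apply: eq_bigr => i _; rewrite mulrA.
Qed.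

(** Termwise differentiation: at the midpoint of [|x|] and 1, the series and its first two formal
    derivatives converge, the latter being multiples of binomial series. *)
Lemma is_derive_pseries_gbinomial a x : `|x| < 1 ->
  is_derive x 1 (fun y => limn (pseries (gbinomial a) y))
    (limn (pseries (pseries_diffs (gbinomial a)) x)).
Proof.
move=> x1; have [h0 h1] := midf_lt x1.
have cvgK b : cvgn (pseries (gbinomial b) ((`|x| + 1) / 2)).
  apply: is_cvg_pseries_gbinomial; rewrite ger0_norm//.
apply: (@pseries_snd_diffs _ _ ((`|x| + 1) / 2)).
- exact: cvgK.
- by rewrite pseries_diffs_gbinomial pseriesZ; apply: is_cvgM (cvgK _); exact: is_cvg_cst.
- rewrite pseries_diffs_gbinomial (_ : pseries_diffs _ =
    fun l => a * ((a - 1) * gbinomial (a - 1 - 1) l)); last first.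
    by apply/funext => l; rewrite -gbinomial_diag /pseries_diffs mulrCA.
  by rewrite !pseriesZ; do 2 (apply: is_cvgM; first exact: is_cvg_cst); exact: cvgK.
- by rewrite [ltRHS]ger0_norm//; exact: le_trans (normr_ge0 x) (ltW h0).
Qed.

(** Coefficientwise this is [gbinomialS], read as [(n + 1) g(n + 1) + n g(n) = a g(n)]. *)
Lemma pseries_gbinomial_ode a x : `|x| < 1 ->
  (1 + x) * limn (pseries (pseries_diffs (gbinomial a)) x) =
  a * limn (pseries (gbinomial a) x).
Proof.
move=> x1.
have cF := is_cvg_pseries_gbinomial (a := a) x1.
have cF' : cvgn (pseries (pseries_diffs (gbinomial a)) x).
  rewrite pseries_diffs_gbinomial pseriesZ; apply: is_cvgM; first exact: is_cvg_cst.
  exact: is_cvg_pseries_gbinomial.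
have h : a * pseries (gbinomial a) x n @[n --> \oo] -->
  a * limn (pseries (gbinomial a) x) by apply: cvgMl_tmp; exact: cF.
apply: cvg_unique h => //.
(* The factor [x] raises degrees by one, so the partial sums match only after a shift. *)
rewrite /= -(cvg_shiftS (fun n => a * pseries (gbinomial a) x n)) mulrDl mul1r /=.
rewrite [X in X @ _ --> _](_ : _ = (fun n =>
   pseries (pseries_diffs (gbinomial a)) x n.+1 +
   x * pseries (pseries_diffs (gbinomial a)) x n)).
  by apply: cvgD; [rewrite cvg_shiftS; exact: cF'|apply: cvgMl_tmp; exact: cF'].
apply/funext => n; rewrite /pseries /series /= !mulr_sumr.
rewrite big_nat_recl// [LHS]big_nat_recl// -addrA; congr (_ + _).
  by rewrite /pseries_diffs gbinomialS subr0 mulrA.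
rewrite -big_split; apply: eq_bigr => i _ /=.
rewrite /pseries_diffs gbinomialS exprS; ring.
Qed.

Lemma is_derive_addl a x : is_derive x 1 (fun z : R => a + z) 1.
Proof.
have := is_deriveD (is_derive_cst a x 1) (is_derive_id x 1).
by move=> /is_derive_eq; apply; rewrite add0r.
Qed.

(** By the differential equation, the quotient of the series by [(1 + y)^a] has derivative zero, and
    it is 1 at 0. *)
Lemma binomial_series a x : 0 <= x < 1 ->
  pseries (gbinomial a) x @ \oo --> (1 + x) `^ a.
Proof.
move=> /andP[x0 x1].
pose F (y : R) := limn (pseries (gbinomial a) y).
suff <- : F x = (1 + x) `^ a.
  by apply: is_cvg_pseries_gbinomial; rewrite ger0_norm.
pose G (y : R) : R := F y * (1 + y) `^ (- a).
have dG (y : R) : -1 < y < 1 -> is_derive y 1 G 0.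
  move=> /andP[y0 y1]; have y1' : `|y| < 1 by rewrite ltr_norml y0 y1.
  have yp : 0 < 1 + y by lra.
  have dF := is_derive_pseries_gbinomial a y1'.
  have dP : is_derive y 1 (fun z => (1 + z) `^ (- a))
      (- a * (1 + y) `^ (- a - 1) * 1).
    exact: (@is_derive1_comp R (fun z : R => z `^ (- a)) (fun z => 1 + z) y _ _
      (is_derive1_powR (- a) yp) (is_derive_addl 1 y)).
  have := is_deriveM dF dP; move=> /is_derive_eq; apply.
  rewrite /GRing.scale /= mulr1.
  rewrite [X in _ + X * _ = _](_ : _ = (1 + y) * (1 + y) `^ (- a - 1)); last first.
    rewrite -{2}(powRr1 (ltW yp)) -powRD; last by rewrite (gt_eqF yp) implybT.
    by congr (_ `^ _); ring.
  have := pseries_gbinomial_ode a y1'; set f := limn _; set f' := limn _.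
  by move=> e; rewrite mulrAC e; ring.
have [||c _] := @MVT_segment _ G (fun=> 0) 0 x x0.
- by move=> y; rewrite in_itv/= => /andP[y0 yx]; apply: dG; apply/andP; split; lra.
- apply: derivable_within_continuous => y; rewrite in_itv/= => /andP[y0 yx].
  by have [] := dG y; first by apply/andP; split; lra.
rewrite mul0r => /eqP; rewrite subr_eq0 => /eqP.
rewrite /G addr0 powR1 mulr1 powRN.
rewrite (_ : F 0 = 1); last first.
  apply/cvg_lim => //; rewrite -cvg_shiftS.
  rewrite [X in X @ _ --> _](_ : _ = cst 1); first exact: cvg_cst.
  apply/funext => n; rewrite /pseries /series /= big_nat_recl// expr0 mulr1.
  rewrite gbinomial0 big1 ?addr0// => i _; rewrite exprS mul0r mulr0//.
have xp : (1 + x) `^ a != 0 by rewrite gt_eqF// powR_gt0//; lra.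
by move=> /(canRL (mulfVK xp)) ->; rewrite mul1r.
Qed.

(** Factoring out [lam^a] leaves the binomial series at [mu / lam < 1]. *)
Lemma cvg_binomial_series lam mu a : 0 < lam -> 0 <= mu < lam ->
  series (fun l => gbinomial a l * lam `^ (a - l%:R) * mu ^+ l) @ \oo -->
  (lam + mu) `^ a.
Proof.
move=> lam0 /andP[mu0 mulam].
have : 0 <= mu / lam < 1 by rewrite divr_ge0 ?(ltW lam0)//= ltr_pdivrMr ?mul1r.
move=> /(binomial_series (a := a)) /(@cvgMl_tmp _ _ _ _ _ (lam `^ a) _).
rewrite -powRM ?(ltW lam0)//; last by rewrite addr_ge0// divr_ge0// ltW.
rewrite (_ : lam * (1 + mu / lam) = lam + mu); last by field; rewrite gt_eqF.
move=> h; rewrite [X in X @ _ --> _](_ : _ =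
  (fun n => lam `^ a * pseries (gbinomial a) (mu / lam) n)); first exact: h.
apply/funext => n; rewrite /pseries /series /= mulr_sumr; apply: eq_bigr => i _.
rewrite powRB ?(gt_eqF lam0) ?implybT// powR_mulrn ?(ltW lam0)// expr_div_n.
by ring.
Qed.

(* The limit is (-1)^m times the coefficient of B^m in (lam + mu (1 - B))^a. *)
Lemma cvg_frac_difference_coef lam mu a m : 0 < lam -> 0 <= mu < lam ->
  series (fun l => gbinomial a l * lam `^ (a - l%:R) * mu ^+ l * 'C(l, m)%:R)
    @ \oo --> gbinomial a m * (lam + mu) `^ (a - m%:R) * mu ^+ m.
Proof.
move=> lam0 mul.
have := cvg_binomial_series (a := a - m%:R) lam0 mul.
move=> /(@cvgMl_tmp _ _ _ _ _ (gbinomial a m * mu ^+ m) _).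
move=> h; rewrite -(cvg_shiftn m) (mulrAC (gbinomial a m)).
rewrite [X in X @ _ --> _](_ : _ = (fun n => gbinomial a m * mu ^+ m *
  series (fun l => gbinomial (a - m%:R) l * lam `^ (a - m%:R - l%:R) *
    mu ^+ l) n)); first exact: h.
apply/funext => n; rewrite /series /= (@big_cat_nat _ _ _ m) ?leq_addl//=.
rewrite big_nat big1 ?add0r => [|i /andP[_ im]]; last first.
  by rewrite bin_small ?mulr0.
rewrite -{1}(add0n m) big_addn addnK mulr_sumr; apply: eq_bigr => i _.
have e := gbinomial_bin a m i.
rewrite addnC natrD opprD addrA exprD; ring: e.
Qed.

(** Shifts beyond [B^k] reach negative indices. The range of summation then no longer depends on
    [l], so the sums over [l] and [m] can be exchanged. *)
Lemma one_minus_B_powE l (f : int -> R) (k : nat) :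
  (forall j : nat, f (Negz j) = 0) ->
  one_minus_B_pow l f k =
  \sum_(m < k.+1) 'C(l, m)%:R * (- 1) ^+ m * f (k - m)%N.
Proof.
move=> f0; rewrite /one_minus_B_pow.
have itE m (z : int) : iter m backward_shift f z = f (z - m%:Z).
  elim: m z => [|m IH] z; first by rewrite subr0.
  by rewrite iterS /backward_shift IH; congr f; lia.
pose g m : R := 'C(l, m)%:R * (- 1) ^+ m * f (k%:Z - m%:Z).
(* On this common range, terms with [m > l] vanish by the binomial coefficient and those with
   [m > k] by [f0]. *)
transitivity (\sum_(0 <= m < l + k.+1) g m).
  rewrite (@big_cat_nat _ _ _ l.+1)//=; last lia.
  rewrite [X in _ = _ + X]big_nat [X in _ = _ + X]big1; last first.
    by move=> m /andP[lm _]; rewrite /g bin_small// !mul0r.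
  by rewrite addr0 big_mkord; apply: eq_bigr => m _; rewrite itE.
rewrite (@big_cat_nat _ _ _ k.+1)//=; last lia.
rewrite [X in _ + X = _]big_nat [X in _ + X = _]big1; last first.
  move=> m /andP[km _]; rewrite /g.
  have -> : k%:Z - m%:Z = Negz (m - k.+1) by rewrite NegzE; lia.
  by rewrite f0 mulr0.
rewrite addr0 big_mkord; apply: eq_bigr => -[m /= mk] _; rewrite /g.
by congr (_ * f _); lia.
Qed.

Lemma one_minus_B_pow_neg l (f : int -> R) (k : nat) :
  (forall j : nat, f (Negz j) = 0) -> one_minus_B_pow l f (Negz k) = 0.
Proof.
move=> f0; apply: big1 => m _.
suff -> : iter m backward_shift f (Negz k) = 0 by rewrite mulr0.
elim: {m}(m : nat) k => [|m IH] k; first exact: f0.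
rewrite iterS /backward_shift (_ : Negz k - 1 = Negz k.+1) ?IH//.
by rewrite !NegzE; lia.
Qed.

Lemma cvg_sum_ord n (u : 'I_n -> R^nat) (s : 'I_n -> R) :
  (forall i, u i @ \oo --> s i) ->
  (fun k => \sum_(i < n) u i k) @ \oo --> \sum_(i < n) s i.
Proof.
elim: n u s => [|n IH] u s us.
  rewrite big_ord0 [X in X @ _ --> _](_ : _ = cst 0); first exact: cvg_cst.
  by apply/funext => k; rewrite big_ord0.
rewrite big_ord_recr [X in X @ _ --> _](_ : _ = fun k =>
  \sum_(i < n) u (widen_ord (leqnSn n) i) k + u ord_max k).
  by apply: cvgD => //; apply: IH => i; exact: us.
by apply/funext => k; rewrite big_ord_recr.
Qed.

Lemma cvg_frac_difference lam mu a (f : int -> R) (k : nat) :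
  (forall j : nat, f (Negz j) = 0) -> 0 < lam -> 0 <= mu < lam ->
  series (frac_difference_term lam mu a f k) @ \oo -->
  \sum_(m < k.+1) (- mu) ^+ m * gbinomial a m * (lam + mu) `^ (a - m%:R) *
    f (k - m)%N.
Proof.
move=> f0 lam0 mul.
rewrite [X in X @ _ --> _](_ : _ = fun n => \sum_(m < k.+1)
  series (fun l => gbinomial a l * lam `^ (a - l%:R) * mu ^+ l * 'C(l, m)%:R) n *
    ((- 1) ^+ m * f (k - m)%N)); last first.
  apply/funext => n; rewrite /series /=.
  under [RHS]eq_bigr do rewrite mulr_suml.
  rewrite exchange_big /=; apply: eq_bigr => l _.
  rewrite /frac_difference_term one_minus_B_powE// mulr_sumr.
  by apply: eq_bigr => m _; ring.
apply: cvg_sum_ord => m.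
rewrite [X in _ --> X](_ : _ = gbinomial a m * (lam + mu) `^ (a - m%:R) * mu ^+ m *
  ((- 1) ^+ m * f (k - m)%N)); last by rewrite (exprNn mu); ring.
by apply: cvgMr_tmp; exact: cvg_frac_difference_coef.
Qed.

Lemma cvg_frac_difference_neg lam mu a (f : int -> R) (k : nat) :
  (forall j : nat, f (Negz j) = 0) ->
  series (frac_difference_term lam mu a f (Negz k)) @ \oo --> 0.
Proof.
move=> f0; rewrite [X in X @ _ --> _](_ : _ = cst 0); first exact: cvg_cst.
apply/funext => n; rewrite /series /= big1// => l _.
by rewrite /frac_difference_term one_minus_B_pow_neg// mulr0.
Qed.

End BinomialSeries.

(** * Panjer recursion *)

Section Panjer.
Context {R : realType}.

(** Both sides are the coefficient of index [k] in one product of three power series, unaffected by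
    truncation above degree [k]. *)
Lemma sum_convolution_exchange (a b p : nat -> R) (k : nat) :
  \sum_(j < k.+1) b j * (\sum_(i < (k - j).+1) a i * p (k - j - i)%N) =
  \sum_(j < k.+1) a j * (\sum_(i < (k - j).+1) b i * p (k - j - i)%N).
Proof.
pose pol (c : nat -> R) := \poly_(i < k.+1) c i.
have polE c i : (i <= k)%N -> (pol c)`_i = c i by rewrite coef_poly ltnS => ->.
have convE (c d : nat -> R) : \sum_(j < k.+1) c j *
    (\sum_(i < (k - j).+1) d i * p (k - j - i)%N) = (pol c * (pol d * pol p))`_k.
  rewrite coefM; apply: eq_bigr => j _; rewrite polE; last by rewrite -ltnS.
  congr (_ * _); rewrite coefM; apply: eq_bigr => -[i /= ik] _.
  by rewrite !polE//; lia.
by rewrite !convE mulrCA.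
Qed.

Lemma is_derive_lincomb n (c : 'I_n -> R) (f : 'I_n -> R -> R) (f' : 'I_n -> R)
    (t : R) : (forall i, is_derive t 1 (f i) (f' i)) ->
  is_derive t 1 (fun x => \sum_(i < n) c i * f i x) (\sum_(i < n) c i * f' i).
Proof.
move=> ff'.
have := is_derive_sum (fun i => is_deriveZ (c i) (ff' i)).
rewrite (_ : \sum_(i < n) _ = fun x => \sum_(i < n) c i * f i x)//.
by apply/funext => x; rewrite fct_sumE.
Qed.

Variables (a : nat -> R) (p : nat -> R -> R).
Hypothesis p0 : forall t, 0 <= t -> p 0 t = expR (- t * a 0%N).
Hypothesis pS : forall k t, 0 <= t ->
  k.+1%:R * p k.+1 t =
  - t * \sum_(j < k.+1) j.+1%:R * a j.+1 * p (k - j)%N t.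

(** The left side is the derivative of [t] times the sum in [pS], with the derivatives of the lower
    [p] replaced by their claimed values. *)
Let panjer_alg k t : 0 <= t ->
  \sum_(j < k.+1) j.+1%:R * a j.+1 * p (k - j)%N t +
  t * \sum_(j < k.+1) j.+1%:R * a j.+1 *
    (- \sum_(i < (k - j).+1) a i * p (k - j - i)%N t) =
  k.+1%:R * \sum_(j < k.+2) a j * p (k.+1 - j)%N t.
Proof.
move=> t0.
(* The weight [k.+1] splits as [j + (k.+1 - j)]; on the second part [pS] produces a double
   convolution. *)
have -> : k.+1%:R * \sum_(j < k.+2) a j * p (k.+1 - j)%N t =
  \sum_(j < k.+2) j%:R * a j * p (k.+1 - j)%N t +
  \sum_(j < k.+2) a j * ((k.+1 - j)%:R * p (k.+1 - j)%N t).
  rewrite mulr_sumr -big_split; apply: eq_bigr => -[j /= jk] _.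
  by rewrite natrB//; ring.
congr (_ + _).
  by rewrite [RHS]big_ord_recl /= !mul0r add0r; apply: eq_bigr => j _.
rewrite [RHS]big_ord_recr /= subnn mul0r mulr0 addr0.
transitivity (- t * \sum_(j < k.+1) a j *
    \sum_(i < (k - j).+1) i.+1%:R * a i.+1 * p (k - j - i)%N t).
  have /= <- := sum_convolution_exchange a (fun j => j.+1%:R * a j.+1) (p ^~ t) k.
  rewrite !mulr_sumr; apply: eq_bigr => j _.
  by rewrite mulrN mulrN mulNr.
rewrite mulr_sumr; apply: eq_bigr => -[j /= jk] _.
by rewrite subSn// pS//; ring.
Qed.

(* The extension F off [0, +oo[ gives access to two-sided derivatives at 0. *)
Lemma panjer_derive k : exists F : R -> R, forall t, 0 <= t ->
  F t = p k t /\
  is_derive t 1 F (- \sum_(j < k.+1) a j * p (k - j)%N t).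
Proof.
elim/ltn_ind: k => -[|k] IH.
  exists (fun t => expR (- t * a 0%N)) => t t0; split; first by rewrite p0.
  rewrite big_ord_recl big_ord0 addr0 /= p0//.
  have d1 : is_derive t 1 (fun t => - t * a 0%N) (- a 0%N).
    rewrite (_ : (fun _ => _) = - a 0%N \*: id); last first.
      by apply/funext => x /=; rewrite /GRing.scale/=; ring.
    have := is_deriveZ (- a 0%N) (is_derive_id t 1).
    by move=> /is_derive_eq; apply; rewrite /GRing.scale/= mulr1.
  have := is_derive1_comp (is_derive_expR _) d1.
  by move=> /is_derive_eq; apply; ring.
(* Extensions for all indices up to [k] at once; [id] is a dummy value beyond. *)
have /choice[F HF] : forall i, exists F : R -> R, (i <= k)%N ->
    forall t, 0 <= t -> F t = p i t /\
      is_derive t 1 F (- \sum_(j < i.+1) a j * p (i - j)%N t).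
  move=> i; have [ik|ik] := leqP i k; last by exists id => //; lia.
  by have [F HF] := IH i ik; exists F.
pose G t := \sum_(j < k.+1) j.+1%:R * a j.+1 * F (k - j)%N t.
have k0 : k.+1%:R != 0 :> R by rewrite pnatr_eq0.
(* The right side of [pS] divided by [k.+1], with the extensions in place of [p]. *)
exists (- k.+1%:R^-1 \*: (id * G)) => t t0.
have Fp (j : 'I_k.+1) : F (k - j)%N t = p (k - j)%N t.
  by have [] := HF (k - j)%N (leq_subr _ _) t t0.
have GE : G t = \sum_(j < k.+1) j.+1%:R * a j.+1 * p (k - j)%N t.
  by apply: eq_bigr => j _; rewrite Fp.
split.
  apply: (mulfI k0); rewrite pS// -GE /= /GRing.scale /= mulNr mulrN mulVKf//.
  by rewrite mulNr.
have dF (j : 'I_k.+1) : is_derive t 1 (F (k - j)%N)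
    (- \sum_(i < (k - j).+1) a i * p (k - j - i)%N t).
  by have [] := HF (k - j)%N (leq_subr _ _) t t0.
have dG := is_derive_lincomb (fun j : 'I_k.+1 => j.+1%:R * a j.+1) dF.
have := is_deriveZ (- k.+1%:R^-1) (is_deriveM (is_derive_id t 1) dG).
move=> /is_derive_eq; apply; rewrite /GRing.scale /= mulr1 addrC -/(G t) GE.
by rewrite panjer_alg// mulNr mulKf.
Qed.

End Panjer.

(** * Laplace transforms and moments *)

Section LaplaceMoments.
Context {R : realType} {d : measure_display} {T : measurableType d}.
Variables (P : probability T R) (Y : {RV P >-> R}).
Hypothesis Y0 : forall w, 0 <= Y w.

(** For [s > 0], this is [(-1)^k] times the [k]-th derivative of the Laplace transform of [Y]. *)
Definition laplace_moment (k : nat) (s : R) : R :=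
  \int[P]_(w in setT) (Y w ^+ k * expR (- s * Y w)).

(** A single term of the exponential series is at most its sum: [(s y)^k / k! <= exp(s y)]. *)
Lemma expr_expR_le k (s y : R) : 0 < s -> 0 <= y ->
  y ^+ k * expR (- s * y) <= k`!%:R / s ^+ k.
Proof.
move=> s0 y0.
have k0 : 0 < k`!%:R :> R by rewrite ltr0n fact_gt0.
have sy0 : 0 <= s * y by rewrite mulr_ge0// ltW.
have : (s * y) ^+ k / k`!%:R <= expR (s * y).
  case: k k0 => [|k] k0.
    by rewrite expr0 fact0 divr1 (le_trans _ (expR_ge1Dx _))// lerDl.
  by apply: le_trans (expR_ge1Dxn k sy0); rewrite lerDr.
rewrite ler_pdivrMr// exprMn mulNr expRN => h.
rewrite ler_pdivrMr ?expR_gt0// mulrAC ler_pdivlMr ?exprn_gt0//.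
by rewrite mulrC [leRHS]mulrC.
Qed.

Lemma integrable_laplace_moment k (s : R) : 0 < s ->
  P.-integrable setT (EFin \o (fun w => Y w ^+ k * expR (- s * Y w))).
Proof.
move=> s0.
apply: le_integrable (@finite_measure_integrable_cst _ _ _ P setT
  (k`!%:R / s ^+ k) measurableT) => //.
- apply/measurable_EFinP; apply: measurable_funM; first exact: measurable_funX.
  apply: (measurableT_comp (@measurable_expR R)).
  exact: measurable_funM.
- move=> w _ /=; rewrite lee_fin ger0_norm; last first.
    by rewrite mulr_ge0 ?expR_ge0// exprn_ge0.
  by rewrite (le_trans (expr_expR_le _ s0 (Y0 w)))// ler_norm.
Qed.

Lemma is_derive_laplace_integrand k (y s : R) :
  is_derive s 1 (fun x => y ^+ k * expR (- x * y))
    (- (y ^+ k.+1 * expR (- s * y))).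
Proof.
have d1 : is_derive s 1 (fun x : R => - x * y) (- y).
  rewrite (_ : (fun _ => _) = - y \*: id); last first.
    by apply/funext => x /=; rewrite /GRing.scale/=; ring.
  have := is_deriveZ (- y) (is_derive_id s 1).
  by move=> /is_derive_eq; apply; rewrite /GRing.scale/= mulr1.
have := is_deriveZ (y ^+ k) (is_derive1_comp (is_derive_expR _) d1).
move=> /is_derive_eq; apply; rewrite /GRing.scale/= exprS; ring.
Qed.

Lemma is_derive_laplace_moment k (s : R) : 0 < s ->
  is_derive s 1 (laplace_moment k) (- laplace_moment k.+1 s).
Proof.
move=> s0; pose f x w : R := Y w ^+ k * expR (- x * Y w).
have s2 : 0 < s / 2 by rewrite divr_gt0.
(* To the right of [s / 2] the exponential is at most its value there, so this constant dominates
   the derivatives of the integrand. *)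
pose G (w : T) : R := k.+1`!%:R / (s / 2) ^+ k.+1.
have Is : `]s / 2, s + 1[%classic s by rewrite /= in_itv/=; apply/andP; split; lra.
have intf x : `]s / 2, s + 1[%classic x -> P.-integrable setT (EFin \o f x).
  rewrite /= in_itv/= => /andP[x0 _].
  by apply: integrable_laplace_moment; exact: lt_trans x0.
have df x w : `]s / 2, s + 1[%classic x -> setT w -> derivable (f ^~ w) x 1.
  by move=> _ _; have [] := is_derive_laplace_integrand k (Y w) x.
have G0 w : 0 <= G w by rewrite /G divr_ge0 ?exprn_ge0// ltW.
have intG : P.-integrable setT (EFin \o G).
  exact: finite_measure_integrable_cst.
have d1E x w : partial1of2 f x w = - (Y w ^+ k.+1 * expR (- x * Y w)).
  rewrite partial1of2E.
  by have [_ ->] := is_derive_laplace_integrand k (Y w) x.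
have Gub x w : `]s / 2, s + 1[%classic x -> setT w ->
    `|partial1of2 f x w| <= G w.
  rewrite /= in_itv/= => /andP[x0 _] _; rewrite d1E normrN ger0_norm; last first.
    by rewrite mulr_ge0 ?expR_ge0// exprn_ge0.
  apply: le_trans (expr_expR_le k.+1 s2 (Y0 w)).
  rewrite ler_wpM2l ?exprn_ge0// ler_expR ler_wpM2r// lerN2; exact: ltW.
have dF := derivable_under_integral measurableT Is intf df G0 intG Gub.
have := differentiation_under_integral measurableT Is intf df G0 intG Gub.
rewrite derive1E => eF; apply: DeriveDef; first exact: dF.
rewrite [LHS]eF -mulN1r -RintegralZl//; last exact: integrable_laplace_moment.
by apply: eq_Rintegral => w _; rewrite d1E mulN1r.
Qed.

End LaplaceMoments.

(** * Panjer recursion for Laplace moments *)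

Section PanjerRecursion.
Context {R : realType} {d : measure_display} {T : measurableType d}.
Variables (P : probability T R) (Y : {RV P >-> R}).
Hypothesis Y0 : forall w, 0 <= Y w.
Variables (A : nat -> R -> R) (t : R).
Hypothesis dA : forall j (s : R), 0 < s ->
  is_derive s 1 (A j) (- (j.+1%:R * A j.+1 s)).
Hypothesis laplaceY : forall s : R, 0 < s ->
  laplace_moment Y 0 s = expR (- t * A 0 s).

(** Division by [k!] makes [m] obey the same differential relation as [A]. *)
Let m k (s : R) : R := laplace_moment Y k s / k`!%:R.

Let dm k (s : R) : 0 < s -> is_derive s 1 (m k) (- (k.+1%:R * m k.+1 s)).
Proof.
move=> s0.
have := is_deriveZ (k`!%:R^-1) (is_derive_laplace_moment Y0 k s0).
rewrite (_ : _ \*: _ = m k); last by apply/funext => x; rewrite /= /GRing.scale /= /m mulrC.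
move=> /is_derive_eq; apply; rewrite /GRing.scale/= /m factS natrM.
have h1 : k`!%:R != 0 :> R by rewrite pnatr_eq0 -lt0n fact_gt0.
by field; rewrite h1 nat1r pnatr_eq0.
Qed.

Lemma near_eq_is_derive_unique (f g : R -> R) (s u v : R) :
  (\forall x \near s, f x = g x) ->
  is_derive s 1 f u -> is_derive s 1 g v -> u = v.
Proof.
move=> fg [_ <-] [_ <-]; exact: near_eq_derive.
Qed.

(** Induction on [k]: the base case is [L' = - t psi' L], and each further case is the
    [s]-derivative of the preceding one. *)
Lemma laplace_panjer k (s : R) : 0 < s ->
  k.+1%:R * m k.+1 s =
  - t * \sum_(j < k.+1) j.+1%:R * A j.+1 s * m (k - j)%N s.
Proof.
elim: k s => [|k IH] s s0.
  rewrite big_ord_recl big_ord0 addr0 /= mul1r subn0.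
  have m0E (x : R) : 0 < x -> m 0 x = expR (- t * A 0 x).
    by move=> x0; rewrite /m laplaceY// fact0 divr1.
  have d0 := is_derive1_comp (is_derive_expR ((- t \*: A 0%N) s))
    (is_deriveZ (- t) (dA 0 s0)).
  have e : \forall x \near s, m 0 x = expR (- t * A 0 x).
    by near=> x; apply: m0E; near: x; exact: lt_nbhsr.
  have := near_eq_is_derive_unique e (dm 0 s0) d0.
  by rewrite /GRing.scale /= -m0E// => h; apply: oppr_inj; rewrite mul1r in h *; rewrite h; ring.
have e : \forall x \near s, k.+1%:R * m k.+1 x =
    - t * \sum_(j < k.+1) j.+1%:R * A j.+1 x * m (k - j)%N x.
  by near=> x; apply: IH; near: x; exact: lt_nbhsr.
have dl := is_deriveZ k.+1%:R (dm k.+1 s0).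
have dp (j : 'I_k.+1) := is_deriveM (dA j.+1 s0) (dm (k - j)%N s0).
have ds := is_deriveZ (- t) (is_derive_lincomb (fun j : 'I_k.+1 => j.+1%:R) dp).
have e' : \forall x \near s, (k.+1%:R \*: m k.+1) x = (- t \*: (fun x : R =>
    \sum_(j < k.+1) j.+1%:R * (A j.+1 * m (k - j)%N) x)) x.
  near=> x; rewrite /= /GRing.scale /=.
  transitivity (- t * \sum_(j < k.+1) j.+1%:R * A j.+1 x * m (k - j)%N x).
    by near: x.
  by congr (_ * _); apply: eq_bigr => j _; rewrite -mulrA.
have := near_eq_is_derive_unique e' dl ds.
rewrite /GRing.scale /= mulrN mulNr => /oppr_inj h.
have k0 : k.+1%:R != 0 :> R by rewrite pnatr_eq0.
apply: (mulfI k0); rewrite h mulrCA mulNr -mulrN; congr (t * _).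
apply: oppr_inj; rewrite opprK -sumrN.
transitivity (\sum_(j < k.+1) (j.+1%:R * (k - j).+1%:R * A j.+1 s * m (k - j).+1 s)
   + \sum_(j < k.+1) j.+1%:R * j.+2%:R * A j.+2 s * m (k - j)%N s).
  rewrite -big_split; apply: eq_bigr => j _ /=; ring.
(* Shifting [j] in the second sum gives both the same products, with weights [k.+1 - j] and [j]
   adding up to [k.+1]; the new end terms have weight zero. *)
transitivity (\sum_(j < k.+2) (k.+1 - j)%:R * (j.+1%:R * A j.+1 s * m (k.+1 - j)%N s)
   + \sum_(j < k.+2) j%:R * (j.+1%:R * A j.+1 s * m (k.+1 - j)%N s)).
  rewrite [X in _ = X + _]big_ord_recr /= subnn mul0r addr0.
  rewrite [X in _ = _ + X]big_ord_recl /= mul0r add0r.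
  congr (_ + _); apply: eq_bigr => -[j /= jk] _; rewrite ?subSS ?subSn//.
    by ring.
  by rewrite /bump /= add1n; ring.
rewrite mulr_sumr -big_split; apply: eq_bigr => -[j /= jk] _.
by rewrite -mulrDl -natrD subnK.
Unshelve. all: by end_near. Qed.

End PanjerRecursion.

(** * Poisson process at a random time *)

Section TimeChange.
Context {R : realType} {d : measure_display} {T : measurableType d}.
Variables (P : probability T R) (mu : R) (N : R -> {RV P >-> nat}).
Hypothesis mu0 : 0 < mu.
Hypothesis hN : is_poisson_process P mu (fun t w => N t w).

(** Without the positivity test of [poisson_pmf], the formula is continuous in [s] at 0 as well. *)
Let pmf (k : nat) (s : R) : R := (mu * s) ^+ k / k`!%:R * expR (- (mu * s)).

Let pmf_ge0 k (s : R) : 0 <= s -> 0 <= pmf k s.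
Proof.
move=> s0; apply: mulr_ge0; last exact: expR_ge0.
by apply: divr_ge0 => //; apply: exprn_ge0; rewrite mulr_ge0// ltW.
Qed.

Let pmf_le1 k (s : R) : 0 <= s -> pmf k s <= 1.
Proof.
move=> s0; rewrite /pmf mulrAC ler_pdivrMr ?ltr0n ?fact_gt0// mul1r.
have := @expr_expR_le R k 1 (mu * s) ltr01.
by rewrite mulN1r expr1n divr1; apply; rewrite mulr_ge0// ltW.
Qed.

Let measurable_nat_preimage (X : {RV P >-> nat}) k :
  measurable [set w | X w = k].
Proof.
have -> : [set w | X w = k] = setT `&` (X @^-1` [set k]) by rewrite setTI.
exact: measurable_funP.
Qed.

(** Since [N 0 = 0] only almost surely, the value and the increment from 0 are compared off a null
    set [Z]. *)
Lemma poisson_marginal (s : R) k : 0 < s ->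
  P [set w | N s w = k] = (pmf k s)%:E.
Proof.
move=> s0; case: hN => _ _ N0 _ /(_ 0 s k (lexx 0) s0).
rewrite subr0 /poisson_pmf mulr_gt0// => <-.
pose Z := ~` [set w | N 0 w = 0%N].
have mZ : measurable Z by apply: measurableC; exact: measurable_nat_preimage.
have Z0 : P Z = 0%E by apply: measure_negligible.
have mD : measurable [set w | (N s w - N 0 w)%N = k].
  have mf : measurable_fun setT (fun w => (N s w - N 0 w)%N).
    by apply: measurable_fun_subn; exact: measurable_funP.
  by have := mf measurableT [set k] I; rewrite setTI.
rewrite -(measureU0 (measurable_nat_preimage (N s) k) mZ Z0).
rewrite -[RHS](measureU0 mD mZ Z0); congr (P _).
apply/seteqP; split=> w /= [Nk|Zw]; [|by right| |by right].
- by have [N0w|] := pselect (N 0 w = 0%N); [left; rewrite N0w subn0|right].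
- by have [N0w|] := pselect (N 0 w = 0%N); [left; rewrite N0w subn0 in Nk|right].
Qed.

Variable Y : {RV P >-> R}.
Hypothesis Y0 : forall w, 0 <= Y w.
Hypothesis indep : forall (s : R) k (B : set R), 0 <= s -> measurable B ->
  P ([set w | N s w = k] `&` Y @^-1` B) =
  (P [set w | N s w = k] * P (Y @^-1` B))%E.

(* Discretization of Y from strictly above, as paths of N are only right-continuous. *)
Let idx (n : nat) (w : T) : nat := Num.truncn (n.+1%:R * Y w).
Let grid (n j : nat) : R := j.+1%:R / n.+1%:R.
Let Yn (n : nat) (w : T) : R := grid n (idx n w).
Let cell (n j : nat) : set T := [set w | idx n w = j].

Let YnE n w : Y w < Yn n w <= Y w + n.+1%:R^-1.
Proof.
have n0 : 0 < n.+1%:R :> R by rewrite ltr0n.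
have /truncn_itv/andP[h1 h2] : 0 <= n.+1%:R * Y w by rewrite mulr_ge0.
apply/andP; split; rewrite /Yn /grid -/(idx n w).
  by rewrite ltr_pdivlMr// mulrC.
rewrite ler_pdivrMr// mulrDl mulVf ?gt_eqF// -natr1 lerD2r mulrC.
exact: h1.
Qed.

Let grid_gt0 n j : 0 < grid n j. Proof. by rewrite divr_gt0// ltr0n. Qed.

Let cellE n j : cell n j = Y @^-1` `[j%:R / n.+1%:R, j.+1%:R / n.+1%:R[.
Proof.
have n0 : 0 < n.+1%:R :> R by rewrite ltr0n.
apply/seteqP; split=> w; rewrite /cell /idx /= in_itv /= ler_pdivrMr// ltr_pdivlMr//.
  move=> <-; rewrite ![Y w * _]mulrC; apply: truncn_itv; exact: mulr_ge0.
by rewrite ![Y w * _]mulrC => h; exact: truncn_def.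
Qed.

Let measurable_cell n j : measurable (cell n j).
Proof.
by rewrite cellE -[X in measurable X]setTI; exact: measurable_funP.
Qed.

Let trivIset_cell n : trivIset setT (cell n).
Proof. by move=> i j _ _ [w [<- <-]]. Qed.

Let bigcup_cell n : \bigcup_j cell n j = setT.
Proof. by apply/seteqP; split=> // w _; exists (idx n w). Qed.

Let hit (k n : nat) : set T := [set w | N (Yn n w) w = k].

Let hitE k n : hit k n = \bigcup_j ([set w | N (grid n j) w = k] `&` cell n j).
Proof.
apply/seteqP; split=> [w h|w [j _ [/= h1 h2]]]; first by exists (idx n w).
by rewrite /hit /= /Yn h2.
Qed.

Let measurable_hit_cell k n j :
  measurable ([set w | N (grid n j) w = k] `&` cell n j).
Proof. by apply: measurableI => //; exact: measurable_nat_preimage. Qed.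

Let measurable_hit k n : measurable (hit k n).
Proof. by rewrite hitE; exact: bigcup_measurable. Qed.

Let measurable_pmf k : measurable_fun setT (pmf k).
Proof.
apply: measurable_funM.
  by apply: measurable_funM => //; apply: measurable_funX; exact: measurable_funM.
apply: (measurableT_comp (@measurable_expR R)).
by apply: measurableT_comp => //; exact: measurable_funM.
Qed.

Let measurable_Yn n : measurable_fun setT (Yn n).
Proof.
have mi : measurable_fun setT (idx n).
  move=> _ B _; rewrite setTI.
  have -> : idx n @^-1` B = \bigcup_(j in B) cell n j.
    apply/seteqP; split=> [w Bw|w [j Bj wj]]; first by exists (idx n w).
    by rewrite /preimage /= wj.
  by apply: bigcup_measurable => j _.
by apply: (measurableT_comp (f := grid n)).
Qed.

(** On each cell [Yn n] is constant, so independence factors the probability; the cells are then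
    summed. *)
Let prob_hit k n : P (hit k n) = (\int[P]_w (pmf k (Yn n w))%:E)%E.
Proof.
rewrite hitE measure_semi_bigcup//; first last.
- exact: bigcup_measurable.
- by move=> i j _ _ [w [[_ <-] [_ <-]]].
rewrite -(bigcup_cell n) ge0_integral_bigcup//; first last.
- by move=> w _; rewrite lee_fin pmf_ge0// ltW// grid_gt0.
- rewrite bigcup_cell; apply/measurable_EFinP.
  by apply: measurableT_comp => //; exact: measurable_Yn.
apply: eq_eseriesr => j _.
have := indep k (ltW (grid_gt0 n j))
  (measurable_itv `[j%:R / n.+1%:R, j.+1%:R / n.+1%:R[).
rewrite -cellE poisson_marginal// => h; apply: (etrans h).
rewrite (eq_integral (fun=> (pmf k (grid n j))%:E)); last first.
  by move=> w; rewrite inE /cell /= /Yn => ->.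
by rewrite integral_cst.
Qed.

Let cvg_Yn w : Yn ^~ w @ \oo --> Y w.
Proof.
apply: (@squeeze_cvgr _ _ _ _ (cst (Y w)) (fun n => Y w + n.+1%:R^-1)).
- by apply: nearW => n; have /andP[/ltW -> ->] := YnE n w.
- exact: cvg_cst.
- by rewrite -[X in _ --> X]addr0; apply: cvgD; [exact: cvg_cst|exact: cvg_harmonic].
Qed.

(** [Yn n w] tends to [Y w] strictly from the right, so right-continuity brings the two counts
    within distance less than 1; being integers, they agree. *)
Let near_hit w : \forall n \near \oo, N (Yn n w) w = N (Y w) w.
Proof.
case: hN => _ /(_ w (Y w) (Y0 w)) /cvgrPdist_lt /(_ 1 ltr01) [e /= e0 he] _ _ _.
move/cvgrPdist_lt: (cvg_Yn (w := w)) => /(_ e e0).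
apply: filterS => n Yne.
have /= := he (Yn n w) Yne; have /andP[-> _] := YnE n w; move=> /(_ isT).
rewrite ltr_norml; set x := N (Y w) w; set y := N _ w => /andP[h1 h2].
have h1' : (y < x.+1)%N by rewrite -(ltr_nat R) -natr1; lra.
have h2' : (x < y.+1)%N by rewrite -(ltr_nat R) -natr1; lra.
lia.
Qed.

(** As [near_hit] holds for every [w], the event is exactly the lower limit of the events
    [hit k n]. *)
Let measurable_limit k : measurable [set w | N (Y w) w = k].
Proof.
have -> : [set w | N (Y w) w = k] = \bigcup_m \bigcap_(n in [set n | (m <= n)%N]) hit k n.
  apply/seteqP; split=> w /=.
    move=> <-; have [m _ hm] := near_hit w.
    by exists m => // n /= mn; exact: hm.
  move=> [m _ hm]; have [m' _ hm'] := near_hit w.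
  rewrite -(hm' (maxn m m')) /= ?leq_maxr//.
  by apply: (hm (maxn m m')); rewrite /= leq_maxl.
apply: bigcup_measurable => m _; apply: bigcap_measurable => [|n _] //.
by exists m => /=.
Qed.

(** Both sides of [prob_hit] pass to the limit by dominated convergence, with bound 1. *)
Lemma poisson_time_change k :
  P [set w | N (Y w) w = k] = (\int[P]_w (pmf k (Y w))%:E)%E.
Proof.
have c1 : P.-integrable setT (EFin \o cst (1 : R)).
  exact: finite_measure_integrable_cst.
have cvg_pmf w : (pmf k (Yn n w))%:E @[n --> \oo] --> (pmf k (Y w))%:E.
  apply: cvg_EFin; first exact: nearW.
  have cY : mu * Yn n w @[n --> \oo] --> mu * Y w.
    by apply: cvgMl_tmp; exact: cvg_Yn.
  apply: cvgM.
    apply: cvgMr_tmp.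
    exact: (cvg_comp _ (fun x => x ^+ k) cY (@exprn_continuous R k (mu * Y w))).
  exact: (cvg_comp _ expR (cvgN cY) (@continuous_expR R (- (mu * Y w)))).
have cvg_hit w : ((\1_(hit k n) w : R)%:E) @[n --> \oo] -->
    (\1_[set w | N (Y w) w = k] w : R)%:E.
  apply: cvg_near_cst; have := near_hit w; apply: filterS => n e.
  congr (_%:E); rewrite !indicE; congr ((nat_of_bool _)%:R).
  by apply/idP/idP; rewrite !inE /hit /= e.
have [||||_ _ lim1] := @dominated_convergence _ _ _ P setT measurableT
  (fun n w => (pmf k (Yn n w))%:E) (fun w => (pmf k (Y w))%:E) _ _ _ _ c1 _.
- move=> n; apply/measurable_EFinP.
  by apply: measurableT_comp => //; exact: measurable_Yn.
- by apply/measurable_EFinP; apply: measurableT_comp.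
- by apply: aeW => w _; exact: cvg_pmf.
- apply: aeW => w n _ /=; rewrite lee_fin ger0_norm ?pmf_le1 ?pmf_ge0//;
    exact: ltW (grid_gt0 _ _).
have [||||_ _ lim2] := @dominated_convergence _ _ _ P setT measurableT
  (fun n w => (\1_(hit k n) w)%:E) (fun w => (\1_[set w | N (Y w) w = k] w)%:E)
  _ _ _ _ c1 _.
- by move=> n; apply/measurable_EFinP; exact: measurable_indic.
- by apply/measurable_EFinP; exact: measurable_indic.
- by apply: aeW => w _; exact: cvg_hit.
- by apply: aeW => w n _ /=; rewrite lee_fin indicE normr_nat lern1 leq_b1.
have <- : (\int[P]_w (\1_[set w | N (Y w) w = k] w)%:E =
    P [set w | N (Y w) w = k])%E by rewrite integral_indic// setIT.
apply: cvg_unique lim1 => //; rewrite /=.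
rewrite [X in X @ _ --> _](_ : _ = fun n => \int[P]_w (\1_(hit k n) w)%:E)%E//.
by apply/funext => n; rewrite integral_indic// setIT; exact/esym/prob_hit.
Qed.

End TimeChange.

(** * Mixture tempered stable subordinator *)

Section MTSSCoefficients.
Context {R : realType}.
Variables alpha lambda c : 'I_2 -> R.
Hypothesis lambda_gt0 : forall i, 0 < lambda i.

(* (-1)^j / j! times the j-th derivative of the Laplace exponent. *)
Definition mtss_coef (j : nat) (s : R) : R :=
  \sum_(i < 2) c i *
    ((-1) ^+ j * gbinomial (alpha i) j * (s + lambda i) `^ (alpha i - j%:R)
     - (j == 0)%:R * lambda i `^ alpha i).

Lemma mtss_coef0 s : mtss_coef 0 s = mtss_exponent alpha lambda c s.
Proof.
by apply: eq_bigr => i _; rewrite gbinomial0 expr0 !mul1r subr0.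
Qed.

(** Differentiation brings down the exponent [alpha i - j], which [gbinomialS] absorbs; the constant
    present at [j = 0] disappears. *)
Lemma is_derive_mtss_coef j (s : R) : 0 < s ->
  is_derive s 1 (mtss_coef j) (- (j.+1%:R * mtss_coef j.+1 s)).
Proof.
move=> s0.
pose g i (x : R) := (-1) ^+ j * gbinomial (alpha i) j *
  (lambda i + x) `^ (alpha i - j%:R) - (j == 0)%:R * lambda i `^ alpha i.
have -> : mtss_coef j = fun x => \sum_(i < 2) c i * g i x.
  by apply/funext => x; apply: eq_bigr => i _; rewrite /g [lambda i + x]addrC.
have dg i : is_derive s 1 (g i) (- (j.+1%:R * ((-1) ^+ j.+1 *
    gbinomial (alpha i) j.+1 * (s + lambda i) `^ (alpha i - j.+1%:R)))).
  have ls0 : 0 < lambda i + s by rewrite addr_gt0.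
  have dp := @is_derive1_comp R (fun z => z `^ (alpha i - j%:R))
    (fun z => lambda i + z) s _ _ (is_derive1_powR _ ls0) (is_derive_addl _ s).
  have := is_deriveB (is_deriveZ ((-1) ^+ j * gbinomial (alpha i) j) dp)
    (is_derive_cst ((j == 0)%:R * lambda i `^ alpha i) s 1).
  move=> /is_derive_eq; apply; rewrite /GRing.scale /= subr0 mulr1.
  rewrite -addrA -opprD natr1 exprS mulN1r !mulNr mulrN opprK.
  rewrite [s + _]addrC.
  transitivity ((-1) ^+ j * ((alpha i - j%:R) * gbinomial (alpha i) j) *
    (lambda i + s) `^ (alpha i - j.+1%:R)); first by ring.
  by rewrite -gbinomialS; ring.
have := is_derive_lincomb c dg; move=> /is_derive_eq; apply.
rewrite mulr_sumr -sumrN; apply: eq_bigr => i _.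
by rewrite mul0r subr0 mulrN mulrCA.
Qed.

End MTSSCoefficients.

Theorem proposition5p1 (R : realType) (d : measure_display)
    (T : measurableType d) (P : probability T R)
    (alpha lambda c : 'I_2 -> R) (mu : R)
    (N : R -> {RV P >-> nat}) (S : R -> {RV P >-> R})
    (halpha : forall i, 0 < alpha i < 1)
    (hlambda : forall i, 0 < lambda i)
    (hc : forall i, 0 <= c i) (hc1 : \sum_(i < 2) c i = 1)
    (hmu : 0 < mu) (hmulambda : forall i, mu <= lambda i / 2)
    (hN : is_poisson_process P mu (fun t w => N t w))
    (hS : is_mtss P alpha lambda c (fun t w => S t w))
    (hNS : independent_processes P (fun t w => N t w) (fun t w => S t w)) :
  let X := time_changed (fun t w => N t w) (fun t w => S t w) in
  let r := marginal P X in
  let rhs (k : int) (t : R) :=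
    - \sum_(i < 2) c i *
        (frac_difference (lambda i) mu (alpha i) (r ^~ t) k
         - lambda i `^ alpha i * r k t) in
  [/\ (* the series defining the fractional difference operators converge *)
      forall (k : int) (t : R) (i : 'I_2), 0 <= t ->
        cvgn (series (frac_difference_term (lambda i) mu (alpha i) (r ^~ t) k)),
      (* the equation for t > 0, and at t = 0 with the right derivative *)
      forall (k : int) (t : R), 0 < t -> is_derive t 1 (r k) (rhs k t),
      forall k : int, h^-1 * (r k h - r k 0) @[h --> 0^'+] --> rhs k 0,
      r 0 0 = 1 &
      forall k : int, k != 0 -> r k 0 = 0].
Proof.
move=> X r rhs.
have [[_ S0 _] laplaceS] := hS.
have r_neg (j : nat) t : r (Negz j) t = 0.
  rewrite /r /marginal (_ : [set w | _] = set0) ?measure0//.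
  by apply/seteqP; split.
(* The bound [mu <= lambda i / 2] enters here, placing [mu] inside the disc of convergence of the
   binomial series. *)
have mulam i : 0 <= mu < lambda i.
  by have := hmulambda i; have := hlambda i; rewrite (ltW hmu)/=; lra.
have cvg_term (t : R) i (k : nat) := @cvg_frac_difference _ (lambda i) mu (alpha i)
  (r ^~ t) k (r_neg ^~ t) (hlambda i) (mulam i).
have cvg_term_neg (t : R) i (k : nat) := @cvg_frac_difference_neg _ (lambda i) mu
  (alpha i) (r ^~ t) k (r_neg ^~ t).
have indep t : 0 <= t -> forall (s : R) k (B : set R), 0 <= s -> measurable B ->
    P ([set w | N s w = k] `&` S t @^-1` B) =
    (P [set w | N s w = k] * P (S t @^-1` B))%E.
  move=> t0 s k B s0 mB; apply: hNS; apply: sub_sigma_algebra.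
    by exists s, [set k].
  by exists t, B.
(* The Poisson weight averaged over [S t] is a Laplace moment at the point [mu]. *)
have rE (k : nat) t : 0 <= t ->
    r k t = mu ^+ k * (laplace_moment (S t) k mu / k`!%:R).
  move=> t0.
  have SY0 w : 0 <= S t w by exact: S0.
  rewrite /r /marginal.
  rewrite (_ : [set w | _] = [set w | N (S t w) w = k]); last first.
    by apply/seteqP; split=> w /=; rewrite /X /time_changed; [case|move=> ->].
  rewrite (poisson_time_change hmu hN SY0 (indep t t0)).
  rewrite mulrCA mulrC -RintegralZl//; last exact: integrable_laplace_moment.
  by apply: eq_Rintegral => w _; rewrite mulNr exprMn; ring.
(* The Panjer coefficients: [(- mu)^j / j!] times the [j]-th derivative of the exponent at [mu]. *)
pose a j : R := mu ^+ j * mtss_coef alpha lambda c j mu.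
have laplace0 t : 0 <= t -> forall s : R, 0 < s ->
    laplace_moment (S t) 0 s = expR (- t * mtss_coef alpha lambda c 0 s).
  move=> t0 s s0; rewrite mtss_coef0.
  have := laplaceS t s t0 s0; rewrite unlock => /(congr1 fine) /= <-.
  by apply: eq_Rintegral => w _; rewrite expr0 mul1r.
have r0E t : 0 <= t -> r 0%N t = expR (- t * a 0%N).
  by move=> t0; rewrite rE// expr0 mul1r fact0 divr1 laplace0// /a expr0 mul1r.
(* The moment recursion at [s = mu], multiplied by [mu^(k + 1) = mu^(j + 1) mu^(k - j)]. *)
have rSE (k : nat) t : 0 <= t -> k.+1%:R * r k.+1 t =
    - t * \sum_(j < k.+1) j.+1%:R * a j.+1 * r (k - j)%N t.
  move=> t0; have SY0 w : 0 <= S t w by exact: S0.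
  rewrite rE// mulrCA.
  rewrite (laplace_panjer SY0 (@is_derive_mtss_coef _ alpha lambda c hlambda)
    (laplace0 t t0) k hmu).
  rewrite mulrCA mulr_sumr; congr (_ * _).
  apply: eq_bigr => -[j /= jk] _; rewrite rE// /a.
  by rewrite -{1}(subnKC (jk : (j <= k)%N)) -addSn exprD; ring.
(* The coefficient of [B^j] in the operator is matched with [a j]; the subtracted
   [lambda i ^ alpha i] affects only [j = 0]. *)
have rhsE (k : nat) t : rhs k t = - \sum_(j < k.+1) a j * r (k - j)%N t.
  rewrite /rhs; congr (- _).
  transitivity (\sum_(i < 2) c i * \sum_(j < k.+1) mu ^+ j *
    ((-1) ^+ j * gbinomial (alpha i) j * (mu + lambda i) `^ (alpha i - j%:R)
     - (nat_of_ord j == 0)%:R * lambda i `^ alpha i) * r (k - j)%N t).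
    apply: eq_bigr => i _; congr (_ * _).
    rewrite /frac_difference (cvg_lim _ (cvg_term t i k))//.
    rewrite big_ord_recl [RHS]big_ord_recl /= !subn0 addrAC; congr (_ + _).
      by rewrite !expr0 !mul1r mulrBl [mu + _]addrC.
    apply: eq_bigr => j _; rewrite mul0r subr0 (exprNn mu) [mu + _]addrC.
    by set e := (-1) ^+ _; ring.
  under eq_bigr do rewrite mulr_sumr.
  rewrite exchange_big /=; apply: eq_bigr => j _.
  rewrite /a /mtss_coef mulr_sumr mulr_suml; apply: eq_bigr => i _.
  by rewrite mulrA (mulrCA (c i)).
have rhs_neg (k : nat) t : rhs (Negz k) t = 0.
  rewrite /rhs big1 ?oppr0// => i _.
  rewrite /frac_difference (cvg_lim _ (cvg_term_neg t i k))//.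
  by rewrite r_neg mulr0 subr0 mulr0.
have ode := @panjer_derive R a (fun k : nat => r k) r0E rSE.
split.
- move=> [k|k] t i t0; apply/cvg_ex; first by eexists; exact: cvg_term.
  by eexists; exact: cvg_term_neg.
- move=> [k|k] t t0.
    have [F HF] := ode k; rewrite rhsE.
    (* Times near [t > 0] are positive, and there [F] and [r] coincide. *)
    have [_ dF] := HF t (ltW t0); apply: near_eq_is_derive dF.
    near=> x; have x0 : 0 <= x by apply: ltW; near: x; exact: lt_nbhsr.
    by have [] := HF x x0.
  rewrite rhs_neg (_ : r _ = cst 0); first exact: is_derive_cst.
  by apply/funext => x; rewrite r_neg.
- move=> [k|k].
    have [F HF] := ode k; rewrite rhsE.
    have [F0 [dF <-]] := HF 0 (lexx 0).
    (* The two-sided derivative of [F] at 0 restricts to the right, where [F] is [r]. *)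
    have := cvg_dnbhs_at_right dF.
    rewrite -F0; apply: cvg_trans; apply: near_eq_cvg.
    near=> h; have h0 : 0 <= h by apply: ltW; near: h; exact: nbhs_right_gt.
    have [<- _] := HF h h0.
    by rewrite /GRing.scale /= mulr1 addr0.
  rewrite rhs_neg; under eq_fun do rewrite !r_neg subrr mulr0; exact: cvg_cst.
- by rewrite r0E// oppr0 mul0r expR0.
- move=> [[|k]|k] // _.
  (* At [t = 0] the factor [- t] annihilates the right side of the recursion. *)
  have k0 : k.+1%:R != 0 :> R by rewrite pnatr_eq0.
  by apply: (mulfI k0); rewrite rSE// oppr0 mul0r mulr0.
Unshelve. all: by end_near. Qed.
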